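(* Let $n\ge 0$ be an integer, let $h\in\mathbb{Z}$ and $r, w_1, w_2\in\mathbb{N}$, let $q\in\mathbb{C}_p$ with $q\neq 1$ and $|1-q|_p<p^{-1/(p-1)}$, and let $x\in\mathbb{C}_p$ with $|x|_p\le 1$. Then $$\sum_{i=0}^{n}\binom{n}{i}[w_2]_q^{n-i}[w_1]_q^{i-r}\beta_{i,q^{w_1}}^{(h,r)}(w_2x)\,T_{n,i}^{(h,r)}(w_1|q^{w_2})=\sum_{i=0}^{n}\binom{n}{i}[w_1]_q^{n-i}[w_2]_q^{i-r}\beta_{i,q^{w_2}}^{(h,r)}(w_1x)\,T_{n,i}^{(h,r)}(w_2|q^{w_1}),$$ where, for $w\in\mathbb{N}$ and $0\le i\le n$, $$T_{n,i}^{(h,r)}(w|Q)=\sum_{j_1,\dots,j_r=0}^{w-1}[j_1+\cdots+j_r]_Q^{n-i}\,Q^{\sum_{l=1}^r(h+i-l+1)j_l}.$$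
   Context: $p$ is a fixed prime; $\mathbb{Z}_p$ is the ring of $p$-adic integers; $\mathbb{C}_p$ is the completion of an algebraic closure of $\mathbb{Q}_p$, with absolute value normalized by $|p|_p=p^{-1}$. $\mathbb{N}=\{1,2,3,\dots\}$. For $Q\in\mathbb{C}_p$ with $Q\ne 1$, $|1-Q|_p<p^{-1/(p-1)}$ and $z\in\mathbb{C}_p$ with $|z|_p\le1$, put $Q^z=\exp(z\log Q)$ ($p$-adic exponential and logarithm) and $[z]_Q=\frac{1-Q^z}{1-Q}$. If $q$ satisfies $q\ne1$, $|1-q|_p<p^{-1/(p-1)}$, then so does $q^{w}$ for every $w\in\mathbb{N}$. The $Q$-Volkenborn integral of a uniformly differentiable function $f:\mathbb{Z}_p\to\mathbb{C}_p$ (i.e. one whose difference quotient $\frac{f(x)-f(y)}{x-y}$ has a limit $f'(a)$ as $(x,y)\to(a,a)$, for every $a\in\mathbb{Z}_p$) is $$\int_{\mathbb{Z}_p}f(y)\,d\mu_Q(y)=\lim_{N\to\infty}\frac{1}{[p^N]_Q}\sum_{y=0}^{p^N-1}f(y)Q^y .$$ Multiple integrals are iterated integrals. For $n\ge0$, $h\in\mathbb{Z}$, $r\in\mathbb{N}$ define $$\beta_{n,Q}^{(h,r)}(z)=\int_{\mathbb{Z}_p}\cdots\int_{\mathbb{Z}_p}[z+y_1+\cdots+y_r]_Q^{n}\,Q^{\sum_{l=1}^r(h-l)y_l}\,d\mu_Q(y_1)\cdots d\mu_Q(y_r).$$ Convention: $a^0=1$ for all $a$, including $a=0$. *)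

(* Defs.v *)
From mathcomp Require Import all_boot all_order all_algebra.
From mathcomp Require Import all_classical all_reals all_analysis.

Set Implicit Arguments.
Unset Strict Implicit.
Unset Printing Implicit Defensive.

Import Order.TTheory GRing.Theory Num.Theory.
Import numFieldNormedType.Exports.
Local Open Scope classical_set_scope.
Local Open Scope ring_scope.

Record absvalue (R : realType) (K : fieldType) := Absvalue {
  absv :> K -> R;
  absv_ge0 : forall x, 0 <= absv x;
  absv_eq0 : forall x, absv x = 0 <-> x = 0;
  absvM : forall x y, absv (x * y) = absv x * absv y;
  absvD : forall x y, absv (x + y) <= absv x + absv y
}.

Definition abs_cvg (R : realType) (K : fieldType) (a : absvalue R K)
    (u : nat -> K) (l : K) : Prop :=
  (fun n => a (u n - l)) @ \oo --> (0 : R).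

(* The limit of [u], with value 0 when [u] diverges. *)
Definition abs_lim (R : realType) (K : fieldType) (a : absvalue R K)
    (u : nat -> K) : K :=
  xget 0 [set l | abs_cvg a u l].

Definition abs_cauchy (R : realType) (K : fieldType) (a : absvalue R K)
    (u : nat -> K) : Prop :=
  forall e : R, 0 < e -> exists N : nat, forall m n : nat,
    (N <= m)%N -> (N <= n)%N -> a (u m - u n) < e.

Definition abs_complete (R : realType) (K : fieldType) (a : absvalue R K) :
    Prop :=
  forall u : nat -> K, abs_cauchy a u -> exists l : K, abs_cvg a u l.

Definition isometric (R : realType) (F K : fieldType)
    (aF : F -> R) (aK : absvalue R K) (i : F -> K) : Prop :=
  forall x : F, aK (i x) = aF x.

Definition is_completion (R : realType) (F K : fieldType)
    (aF : F -> R) (aK : absvalue R K) (i : {rmorphism F -> K}) : Prop :=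
  [/\ isometric aF aK i,
      abs_complete aK
    & forall (y : K) (e : R), 0 < e -> exists x : F, aK (y - i x) < e].

Definition padic_abs (R : realType) (p : nat) (x : rat) : R :=
  if x == 0 then 0
  else (p%:R : R) ^ ((logn p `|denq x|%N)%:Z - (logn p `|numq x|%N)%:Z).

(* The tower rat -> Q_p -> algebraic closure of Q_p -> C_p.  It is determined
   by p up to isometric isomorphism, so a statement about C_p is quantified
   over all such towers. *)
Record padic_complex (R : realType) (p : nat) := PadicComplex {
  Qp : fieldType;
  Qpbar : closedFieldType;
  Cp :> fieldType;
  absQp : absvalue R Qp;
  absQpbar : absvalue R Qpbar;
  absCp : absvalue R Cp;
  rat_Qp : {rmorphism rat -> Qp};
  Qp_Qpbar : {rmorphism Qp -> Qpbar};
  Qpbar_Cp : {rmorphism Qpbar -> Cp};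
  Qp_completion : is_completion (@padic_abs R p) absQp rat_Qp;
  Qpbar_algebraic : forall x : Qpbar, algebraicOver Qp_Qpbar x;
  Qpbar_isometric : isometric absQp absQpbar Qp_Qpbar;
  Cp_completion : is_completion absQpbar absCp Qpbar_Cp
}.

Section PadicAnalysis.
Variables (R : realType) (p : nat) (C : padic_complex R p).

Definition padic_int : Type := {x : Qp C | absQp C x <= 1}.

Lemma absQp_nat_le1 (n : nat) : absQp C n%:R <= 1.
Proof.
have [iso _ _] := Qp_completion C.
rewrite -(rmorph_nat (rat_Qp C)) iso /padic_abs.
case: eqP => // _.
have -> : (n%:R : rat) = (n%:Z)%:~R by [].
rewrite denq_int numq_int /= logn1 sub0r -invr_expz -exprnP.
have [->|p_gt0] := posnP p; first by rewrite lognE /= expr0 invr1.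
by rewrite invf_le1 ?exprn_gt0 ?ltr0n // exprn_ege1 // ler1n.
Qed.

Definition nat_padic_int (n : nat) : padic_int := exist _ n%:R (absQp_nat_le1 n).

Definition padic_int_Cp (x : padic_int) : C := Qpbar_Cp C (Qp_Qpbar C (sval x)).

Definition padic_exp (z : C) : C :=
  abs_lim (absCp C) (fun N => \sum_(0 <= k < N) z ^+ k / (k`!)%:R).

Definition padic_log (Q : C) : C :=
  abs_lim (absCp C)
    (fun N => \sum_(1 <= k < N) (-1) ^+ k.+1 * (Q - 1) ^+ k / k%:R).

Definition qpow (Q z : C) : C := padic_exp (z * padic_log Q).

Definition qnum (Q z : C) : C := (1 - qpow Q z) / (1 - Q).

Definition uniformly_differentiable (f : padic_int -> C) : Prop :=
  forall a : padic_int, exists l : C, forall e : R, 0 < e ->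
    exists2 d : R, 0 < d & forall x y : padic_int,
      absQp C (sval x - sval a) < d -> absQp C (sval y - sval a) < d ->
      sval x != sval y ->
      absCp C ((f x - f y) / (padic_int_Cp x - padic_int_Cp y) - l) < e.

Definition is_volkenborn (Q : C) (f : padic_int -> C) (I : C) : Prop :=
  uniformly_differentiable f /\
  abs_cvg (absCp C)
    (fun N => (qnum Q (p ^ N)%:R)^-1 *
       \sum_(0 <= y < p ^ N) f (nat_padic_int y) * qpow Q y%:R) I.

(* The integral of [f], with value 0 when [f] is not uniformly differentiable
   or the limit does not exist. *)
Definition volkenborn (Q : C) (f : padic_int -> C) : C :=
  xget 0 [set I | is_volkenborn Q f I].

(* The integral over y_1 is innermost, the integral over y_r outermost. *)
Fixpoint volkenborn_iter (Q : C) (r : nat) : (r.-tuple padic_int -> C) -> C :=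
  match r with
  | 0 => fun f => f [tuple]
  | r'.+1 => fun f =>
      volkenborn Q (fun y =>
        volkenborn_iter Q (fun ys : r'.-tuple padic_int => f [tuple of rcons ys y]))
  end.

(* [l : 'I_r] stands for the index l + 1 of 1, ..., r. *)
Definition qbeta (h : int) (r n : nat) (Q z : C) : C :=
  volkenborn_iter Q (fun y : r.-tuple padic_int =>
    qnum Q (z + \sum_(l < r) padic_int_Cp (tnth y l)) ^+ n *
    qpow Q (\sum_(l < r) (h - l.+1%:Z)%:~R * padic_int_Cp (tnth y l))).

Definition qT (h : int) (r n i w : nat) (Q : C) : C :=
  \sum_(j : {ffun 'I_r -> 'I_w})
    qnum Q (\sum_(l < r) j l)%:R ^+ (n - i) *
    qpow Q (\sum_(l < r) (h + i%:Z - l.+1%:Z + 1) * (j l)%:Z)%:~R.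

End PadicAnalysis.

(* Main.v *)
Require Import Defs.
From mathcomp Require Import all_boot all_order all_algebra.
From mathcomp Require Import all_classical all_reals all_analysis.
From mathcomp Require Import ring lra.

(** Write [t] for the logarithm of [q] and [e(u)] for [exp u].  Then
    [0 < |t| < rho], where [rho = p ^ (- 1 / (p - 1))] is the radius of
    convergence of the exponential, and [q ^ z = e(z t)] for [|z| <= 1].  All
    bases that occur are exponentials, so that the theorem is about finite linear
    combinations of exponentials of the integration variables.

    The analysis reduces to one integral.  For [Q = e(t')] the Volkenborn sums of
    [y |-> e(c y)] are geometric, and their quotients by [[p ^ N]_Q] tend to
    [(Q - 1) / t' * phi (c + t')], where [phi u = u / (e(u) - 1)] and [phi 0 = 1]
    ([is_volkenborn_exp]).  Expanding [[z + y_1 + ... + y_r]_Q ^ n] by the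
    binomial theorem gives [qbeta_exp]:
      [beta = (1 - Q) ^ - n * \sum_k C(n, k) (-1) ^ k e(k z t')
              \prod_(0 <= l < r) ((Q - 1) / t' * phi ((k + h - l) t'))].

    With [Q = q ^ w1], [t' = w1 t], the powers of [1 - Q], of [[w1]_q] and of
    [[w2]_q] on the left-hand side cancel down to a factor symmetric in [w1] and
    [w2], up to [w1 ^ - r].  The sum over [i] is the umbral form of
    [((1 - u) + u (1 - v)) ^ n = (1 - u v) ^ n] ([umbral_pow_comp]), and then the
    sum over [j_1, ..., j_r] is a product of [r] geometric sums
    ([one_side_eq]).  What is left is, with [m = k + h - l],
      [phi (m w1 t) / w1 * \sum_(0 <= j < w1) e(m w2 t) ^ j],
    which equals [m t (e(m w1 w2 t) - 1) / ((e(m w1 t) - 1) (e(m w2 t) - 1))], or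
    [1] when [m = 0]: it is symmetric in [w1] and [w2] ([symmetric_factorC]).

    Two facts about the exponential and the logarithm carry the analysis.  By
    Legendre's formula the linear term of either series strictly dominates the
    later ones ([abs_exp_term_le]), hence [|e(u) - 1| = |u|] and the
    exponential is differentiable.  And [log (e(t')) = t'], which is needed to
    evaluate powers of [Q = q ^ w1], holds because [log Q] is the limit of
    [(Q ^ (p ^ n) - 1) / p ^ n] ([padic_log_slope]), and for [Q = e(t')] this
    quotient is a difference quotient of the exponential at the origin. *)

Set Implicit Arguments.
Unset Strict Implicit.
Unset Printing Implicit Defensive.

Import Order.TTheory GRing.Theory Num.Theory.
Import numFieldNormedType.Exports.
Local Open Scope ring_scope.

(** * Absolute values and convergence *)

Section AbsoluteValue.
Variables (R : realType) (K : fieldType) (a : absvalue R K).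

Lemma abs0 : a 0 = 0.
Proof. by have [_ ->] := absv_eq0 a 0. Qed.

Lemma abs_eq0 x : (a x == 0) = (x == 0).
Proof. by have [H1 H2] := absv_eq0 a x; apply/eqP/eqP. Qed.

Lemma abs_gt0 x : (0 < a x) = (x != 0).
Proof. by rewrite lt_def absv_ge0 andbT abs_eq0. Qed.

Lemma abs1 : a 1 = 1.
Proof.
have a1N0 : a 1 != 0 by rewrite abs_eq0 oner_eq0.
by apply: (mulfI a1N0); rewrite -absvM !mulr1.
Qed.

Lemma absN1 : a (- 1) = 1.
Proof.
apply/eqP; rewrite -(@eqrXn2 _ 2) ?absv_ge0 ?ler01 //.
by rewrite expr1n expr2 -absvM mulrNN mulr1 abs1.
Qed.

Lemma absN x : a (- x) = a x.
Proof. by rewrite -mulN1r absvM absN1 mul1r. Qed.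

Lemma absB x y : a (x - y) = a (y - x).
Proof. by rewrite -absN opprB. Qed.

Lemma absX x n : a (x ^+ n) = a x ^+ n.
Proof. by elim: n => [|n IHn]; rewrite ?expr0 ?abs1 // !exprS absvM IHn. Qed.

Lemma absV x : a x^-1 = (a x)^-1.
Proof.
have [->|x0] := eqVneq x 0; first by rewrite invr0 abs0 invr0.
have ax0 : a x != 0 by rewrite abs_eq0.
by apply: (mulfI ax0); rewrite -absvM !divff ?abs1.
Qed.

Lemma abs_cvgP u l : abs_cvg a u l <->
  forall e : R, 0 < e -> exists N, forall n, (N <= n)%N -> a (u n - l) < e.
Proof.
rewrite /abs_cvg; split=> [/cvgr0Pnorm_lt ul e e0|ul].
  have [N _ HN] := ul e e0; exists N => n Nn.
  exact: le_lt_trans (ler_norm _) (HN n Nn).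
apply/cvgr0Pnorm_lt => e e0; have [N HN] := ul e e0.
by exists N => // n /= Nn; rewrite ger0_norm ?absv_ge0 ?HN.
Qed.

Lemma abs_cvg_cst l : abs_cvg a (fun=> l) l.
Proof. by apply/abs_cvgP => e e0; exists 0%N => n _; rewrite subrr abs0. Qed.

Lemma abs_cvg_le (b : nat -> R) u l : (b @ \oo --> (0 : R))%classic ->
  (forall n, a (u n - l) <= b n) -> abs_cvg a u l.
Proof.
move=> b0 ub; apply: (squeeze_cvgr _ (@cvg_cst _ (0 : R) _ _ _) b0).
by apply: nearW => n; rewrite absv_ge0 ub.
Qed.

Lemma abs_cvgD u v l m : abs_cvg a u l -> abs_cvg a v m ->
  abs_cvg a (fun n => u n + v n) (l + m).
Proof.
move=> ul vm; apply: (@abs_cvg_le (fun n => a (u n - l) + a (v n - m))).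
  by rewrite -(addr0 (0 : R)); apply: cvgD.
by move=> n; rewrite opprD addrACA absvD.
Qed.

Lemma abs_cvgM u v l m : abs_cvg a u l -> abs_cvg a v m ->
  abs_cvg a (fun n => u n * v n) (l * m).
Proof.
move=> ul vm.
apply: (@abs_cvg_le (fun n => a (u n - l) * a (v n - m) + a (u n - l) * a m
  + a l * a (v n - m))).
  have -> : (0 : R) = 0 * 0 + 0 * a m + a l * 0 by ring.
  by apply: cvgD; [apply: cvgD|]; apply: cvgM => //; apply: cvg_cst.
move=> n; rewrite -!absvM.
have -> : u n * v n - l * m =
  (u n - l) * (v n - m) + (u n - l) * m + l * (v n - m) by ring.
by apply: le_trans (absvD _ _ _) _; rewrite lerD2r absvD.
Qed.

Lemma abs_cvgMl c u l : abs_cvg a u l -> abs_cvg a (fun n => c * u n) (c * l).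
Proof. exact/abs_cvgM/abs_cvg_cst. Qed.

Lemma abs_cvg_sum (I : finType) (u : I -> nat -> K) (l : I -> K) :
  (forall i, abs_cvg a (u i) (l i)) ->
  abs_cvg a (fun n => \sum_i u i n) (\sum_i l i).
Proof.
move=> ul; elim: (index_enum I) => [|i s IHs].
  by under eq_fun do rewrite big_nil; rewrite big_nil; apply: abs_cvg_cst.
by under eq_fun do rewrite big_cons; rewrite big_cons; apply: abs_cvgD.
Qed.

(** Transfers a bound on the partial sums of a series to its sum. *)
Lemma abs_cvg_ball u l c (B : R) : abs_cvg a u l ->
  (exists N, forall n, (N <= n)%N -> a (u n - c) <= B) -> a (l - c) <= B.
Proof.
move=> /abs_cvgP ul [N uB]; rewrite leNgt; apply/negP => Bl.
have [M HM] := ul _ (etrans (subr_gt0 _ _) Bl).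
have := HM _ (leq_maxl M N); have := uB _ (leq_maxr M N).
set k := maxn M N => h1 h2.
have := absvD a (l - u k) (u k - c); rewrite addrA subrK (absB l (u k)) => h3; lra.
Qed.

Lemma abs_cvg_unique u l m : abs_cvg a u l -> abs_cvg a u m -> l = m.
Proof.
move=> ul /abs_cvgP um; apply/eqP; rewrite -subr_eq0 -abs_eq0.
rewrite eq_le absv_ge0 andbT; apply/ler_addgt0Pr => e e0; rewrite add0r.
apply: (abs_cvg_ball ul); have [N HN] := um e e0.
by exists N => n Nn; exact/ltW/HN.
Qed.

Lemma abs_limE u l : abs_cvg a u l -> abs_lim a u = l.
Proof. by move=> ul; apply: xget_unique => // m /abs_cvg_unique; apply. Qed.

End AbsoluteValue.

Section Nonarchimedean.
Variables (R : realType) (K : fieldType) (a : absvalue R K).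
Hypothesis nat_le1 : forall n, a n%:R <= 1.

(** Expanding [(x + y) ^+ n] with integral binomial coefficients bounds the
    [n]-th power of [a (x + y)] by [n + 1] times the [n]-th power of the
    larger absolute value; exponential growth beats the factor [n + 1]. *)
Lemma abs_ultra x y B : a x <= B -> a y <= B -> a (x + y) <= B.
Proof.
move=> xB yB; have B0 : 0 <= B by exact: le_trans (absv_ge0 a x) xB.
have [B_eq0|B_neq0] := eqVneq B 0.
  have := absvD a x y; have := absv_ge0 a x; have := absv_ge0 a y.
  by rewrite B_eq0 in xB yB *; lra.
have B_gt0 : 0 < B by rewrite lt_def B_neq0.
have pow_le n : a (x + y) ^+ n <= n.+1%:R * B ^+ n.
  rewrite -absX exprDn.
  have : a (\sum_(i < n.+1) x ^+ (n - i) * y ^+ i *+ 'C(n, i))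
      <= \sum_(i < n.+1) a (x ^+ (n - i) * y ^+ i *+ 'C(n, i)).
    elim/big_ind2: _ => [|u1 u2 v1 v2 h1 h2|//]; first by rewrite abs0.
    by apply: le_trans (absvD _ _ _) _; apply: lerD.
  move=> /le_trans; apply.
  have -> : n.+1%:R * B ^+ n = \sum_(i < n.+1) B ^+ n.
    by rewrite sumr_const card_ord mulr_natl.
  apply: ler_sum => i _; rewrite -mulr_natr !absvM -[leRHS]mulr1 !absX.
  apply: ler_pM; rewrite ?mulr_ge0 ?exprn_ge0 ?absv_ge0 //.
  have -> : B ^+ n = B ^+ (n - i) * B ^+ i by rewrite -exprD subnK // -ltnS.
  by apply: ler_pM; rewrite ?exprn_ge0 ?absv_ge0 ?lerXn2r
    ?nnegrE ?absv_ge0.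
rewrite leNgt; apply/negP => Bxy.
pose d := a (x + y) / B - 1.
have d0 : 0 < d by rewrite subr_gt0 ltr_pdivlMr // mul1r.
have bern n : 1 + d *+ n <= (1 + d) ^+ n.
  elim: n => [|n IHn]; first by rewrite mulr0n addr0 expr0.
  rewrite exprS mulrS; apply: (@le_trans _ _ ((1 + d) * (1 + d *+ n))).
    rewrite -mulr_natr; have : (0 : R) <= n%:R by []; nra.
  by rewrite ler_wpM2l // addr_ge0 // ltW.
have dn n : (1 + d) ^+ n <= n.+1%:R.
  by rewrite addrC subrK expr_div_n ler_pdivrMr ?exprn_gt0.
clearbody d.
(* By Bernoulli, [(m * d) ^ 2 <= (1 + d) ^ (2 * m) <= 2 * m + 1 <= 3 * m]. *)
have [m m3] : exists m : nat, 3 / d ^+ 2 < m%:R.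
  by exists (Num.truncn (3 / d ^+ 2)).+1; rewrite truncnS_gt.
have m0 : (0 : R) < m%:R by apply: le_lt_trans m3; rewrite divr_ge0 // exprn_ge0 // ltW.
have m1 : (1 : R) <= m%:R by rewrite ler1n; rewrite ltr0n in m0.
have := dn (m * 2)%N; rewrite exprM -(natr1 (m * 2)) natrM => h1.
have := bern m; rewrite -mulr_natr => h2.
move: m3; rewrite ltr_pdivrMr ?exprn_gt0 // => h3.
have h4 : (1 + d * m%:R) ^+ 2 <= ((1 + d) ^+ m) ^+ 2.
  have d_ge0 := ltW d0.
  by apply: lerXn2r h2; rewrite nnegrE ?exprn_ge0 ?addr_ge0 ?mulr_ge0.
have h5 : (1 + d * m%:R) ^+ 2 = 1 + 2 * (d * m%:R) + m%:R * (m%:R * d ^+ 2) by ring.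
have h6 : m%:R * 3 < m%:R * (m%:R * d ^+ 2) by rewrite ltr_pM2l.
have : 0 < d * m%:R by exact: mulr_gt0.
by move: h1 h4 h5 h6; set u := ((1 + d) ^+ m) ^+ 2; lra.
Qed.

Lemma abs_ultra_sum (I : Type) (s : seq I) (P : pred I) (F : I -> K) B :
  0 <= B -> (forall i, P i -> a (F i) <= B) -> a (\sum_(i <- s | P i) F i) <= B.
Proof.
move=> B0 FB; elim/big_ind: _ => //; first by rewrite abs0.
by move=> *; apply: abs_ultra.
Qed.

Lemma abs_int_le1 (z : int) : a z%:~R <= 1.
Proof. by case: z => n; rewrite ?NegzE ?mulrNz ?absN nat_le1. Qed.

(** An ultrametric triangle is isosceles. *)
Lemma abs_dominant x y : a (y - x) < a x -> a y = a x.
Proof.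
move=> yx; apply/eqP; rewrite eq_le; apply/andP; split.
  by rewrite -(subrK x y); apply: abs_ultra => //; apply: ltW.
rewrite leNgt; apply/negP => lt_yx.
have : a x <= Num.max (a (y - x)) (a y).
  rewrite -{1}(subKr y x) addrC.
  by apply: abs_ultra; rewrite ?absN le_max lexx ?orbT.
by rewrite leNgt gt_max yx lt_yx.
Qed.

Lemma abs_cvgV u l : l != 0 -> abs_cvg a u l -> (forall n, a (u n) = a l) ->
  abs_cvg a (fun n => (u n)^-1) l^-1.
Proof.
move=> l0 ul ual; apply: (@abs_cvg_le _ _ _ (fun n => a (u n - l) / a l ^+ 2)).
  by rewrite -(mul0r (a l ^+ 2)^-1); apply: cvgM => //; apply: cvg_cst.
move=> n; have un0 : u n != 0 by rewrite -(abs_eq0 a) ual abs_eq0.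
have -> : (u n)^-1 - l^-1 = (l - u n) / (u n * l) by field; rewrite l0.
by rewrite absvM absV absvM ual -expr2 absB.
Qed.

(** Ultrametrically, a block of consecutive terms is no larger than its largest
    term, so that the Cauchy criterion only looks at single terms. *)
Lemma abs_series_cvg F : abs_complete a -> abs_cvg a F 0 ->
  exists l, abs_cvg a (fun N => \sum_(0 <= k < N) F k) l.
Proof.
move=> cpl /abs_cvgP F0; apply: cpl => e e0.
have e20 : 0 < e / 2 by rewrite divr_gt0.
have [N HN] := F0 _ e20; exists N => m n Nm Nn.
wlog mn : m n Nm Nn / (m <= n)%N.
  move=> W; case: (leqP m n) => [|/ltnW] mn; first exact: W.
  by rewrite absB; apply: W.
rewrite (big_cat_nat _ mn) //= opprD addNKr absN big_seq.
apply: (@le_lt_trans _ _ (e / 2)); last by rewrite ltr_pdivrMr //; lra.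
apply: abs_ultra_sum; first exact: ltW.
move=> k; rewrite mem_index_iota => /andP[mk _].
by have := HN k (leq_trans Nm mk); rewrite subr0 => /ltW.
Qed.

End Nonarchimedean.

(** * Power series bounds *)

(** Legendre's bound on the valuation of a factorial.  Each quotient
    [n %/ p ^ k] is at most [(n %/ p ^ k.-1 - n %/ p ^ k) / p.-1], so the sum in
    Legendre's formula telescopes; stopping at the last nonzero quotient gains
    the final unit. *)
Lemma logn_fact_le p n : prime p -> (0 < n)%N -> (p.-1 * logn p n`! <= n.-1)%N.
Proof.
move=> pr_p n0; have p1 := prime_gt1 pr_p; have p0 := ltnW p1.
have tele K : (p.-1 * (\sum_(1 <= k < K.+1) n %/ p ^ k) + n %/ p ^ K <= n)%N.
  elim: K => [|K IHK]; first by rewrite big_geq // muln0 expn0 divn1.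
  apply: leq_trans IHK; rewrite big_nat_recr //= mulnDr -addnA leq_add2l.
  by rewrite expnSr divnMA -mulSnr prednK // mulnC leq_divM.
(* [p ^ T] is the largest power of [p] up to [n]: [n %/ p ^ T] is positive, and
   all later quotients vanish. *)
set T := trunc_log p n.
have le_Tn : (T <= n)%N.
  by apply: leq_trans (trunc_logP p1 n0); apply/ltnW/ltn_expl.
rewrite logn_fact // (big_cat_nat (n := T.+1)) //= [X in (_ + X)%N]big_nat [X in (_ + X)%N]big1.
  rewrite addn0 -ltnS prednK // -addn1; apply: leq_trans (tele T).
  by rewrite leq_add2l divn_gt0 ?expn_gt0 ?p0 ?trunc_logP.
move=> k /andP[Tk _]; rewrite divn_small //.
by apply: leq_trans (trunc_log_ltn n p1) _; rewrite leq_pexp2l.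
Qed.

(** Compares the partial sums of a Cauchy product with the product of the partial
    sums, which runs over the whole square of side [N]. *)
Lemma sum_antidiagonal (V : zmodType) (F : nat -> nat -> V) N :
  \sum_(0 <= k < N) \sum_(0 <= i < k.+1) F i (k - i)%N =
  \sum_(0 <= i < N) \sum_(0 <= j < N | (j < N - i)%N) F i j.
Proof.
transitivity (\sum_(0 <= k < N) \sum_(0 <= i < N | (i < k.+1)%N) F i (k - i)%N).
  apply: eq_big_nat => k /andP[_ kN].
  by rewrite (big_nat_widen _ _ N).
rewrite (exchange_big_dep_nat predT) //=; apply: eq_big_nat => i /andP[_ iN].
have -> : \sum_(0 <= j < N | (j < N - i)%N) F i j = \sum_(0 <= j < N - i) F i j.
  by rewrite [RHS](big_nat_widen _ _ N) ?leq_subr.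
transitivity (\sum_(i <= k < N) F i (k - i)%N).
  by rewrite [RHS](big_nat_widenl _ 0).
rewrite -{1}[i]add0n big_addn.
by apply: eq_bigr => j _; rewrite addnK.
Qed.

Section PadicAnalysis.
Variables (R : realType) (p : nat) (C : padic_complex R p).
Hypothesis pr_p : prime p.

Local Notation a := (absCp C).
Local Notation P := (p%:R : R).

Let P_gt1 : 1 < P. Proof. by rewrite ltr1n prime_gt1. Qed.
Let P_gt0 : 0 < P. Proof. exact: lt_trans P_gt1. Qed.

Lemma abs_padic_int_Cp y : a (padic_int_Cp y) = absQp C (sval y).
Proof.
have [isoC _ _] := Cp_completion C.
by rewrite /padic_int_Cp isoC Qpbar_isometric.
Qed.

Lemma abs_nat n : a n.+1%:R = P ^- logn p n.+1.
Proof.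
have [isoC _ _] := Cp_completion C; have [isoQ _ _] := Qp_completion C.
rewrite -(rmorph_nat (Qpbar_Cp C)) isoC -(rmorph_nat (Qp_Qpbar C)).
rewrite Qpbar_isometric -(rmorph_nat (rat_Qp C)) isoQ /padic_abs.
rewrite pnatr_eq0 /=.
have -> : (n.+1%:R : rat) = (n.+1%:Z)%:~R by [].
by rewrite denq_int numq_int /= logn1 sub0r -invr_expz -exprnP.
Qed.

Lemma abs_nat_le1 n : a n%:R <= 1.
Proof.
case: n => [|n]; first by rewrite abs0.
by rewrite abs_nat invf_le1 ?exprn_gt0 // exprn_ege1 // ltW.
Qed.

Lemma Cp_natf_neq0 n : (0 < n)%N -> n%:R != 0 :> C.
Proof.
case: n => // n _; rewrite -(abs_eq0 a) abs_nat.
by rewrite invr_eq0 expf_neq0 // gt_eqF.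
Qed.

Lemma abs_nat_ge n : (0 < n)%N -> n%:R^-1 <= a n%:R.
Proof.
case: n => // n _; rewrite abs_nat lef_pV2 ?posrE ?exprn_gt0 //.
by rewrite -natrX ler_nat dvdn_leq // pfactor_dvdnn.
Qed.

Lemma abs_expp n : a (p ^ n)%:R = P ^- n.
Proof.
have := abs_nat (p ^ n).-1; rewrite prednK ?expn_gt0 ?prime_gt0 // => ->.
by rewrite pfactorK.
Qed.

Lemma expp_neq0 n : (p ^ n)%:R != 0 :> C.
Proof. by rewrite Cp_natf_neq0 // expn_gt0 prime_gt0. Qed.

Lemma abs_expp_cvg0 (c : R) : ((fun n => P ^- n * c) @ \oo --> (0 : R))%classic.
Proof.
have -> : (fun n => P ^- n * c) = (fun n => P^-1 ^+ n * c).
  by apply/funext => n; rewrite exprVn.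
rewrite -(mul0r c); apply: cvgM; last exact: cvg_cst.
by apply: cvg_expr; rewrite ger0_norm ?invf_lt1 // invr_ge0 ltW.
Qed.

Let ultra := abs_ultra abs_nat_le1.
Let ultra_sum := abs_ultra_sum abs_nat_le1.

(** The radius of convergence of the exponential. *)
Definition rho : R := P `^ (- (P - 1)^-1).

Lemma rho_gt0 : 0 < rho. Proof. exact: powR_gt0. Qed.

Lemma rho_le1 : rho <= 1.
Proof.
rewrite -[leRHS](powRr0 P) ler_powR ?(ltW P_gt1) //.
by rewrite oppr_le0 invr_ge0 subr_ge0 ltW.
Qed.

Definition exp_term (z : C) k : C := z ^+ k / (k`!)%:R.

Lemma abs_fact_ge k : rho ^+ k <= a (k.+1`!)%:R.
Proof.
have := abs_nat (k.+1`!).-1; rewrite prednK ?fact_gt0 // => ->.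
rewrite /rho -powR_mulrn ?powR_ge0 // -powRrM -powR_mulrn ?(ltW P_gt0) //.
rewrite -powRN ler_powR ?(ltW P_gt1) // mulNr lerN2.
rewrite mulrC ler_pdivlMr ?subr_gt0 //.
have -> : P - 1 = p.-1%:R by rewrite -subn1 natrB // prime_gt0.
by rewrite -natrM ler_nat mulnC; apply: (@logn_fact_le p k.+1).
Qed.

(** The bound behind everything below: inside the radius of convergence the
    linear term of the exponential dominates all later ones. *)
Lemma abs_exp_term_le z k : a (exp_term z k.+1) <= a z * (a z / rho) ^+ k.
Proof.
rewrite /exp_term absvM absV absX exprS -mulrA ler_wpM2l ?absv_ge0 //.
rewrite expr_div_n ler_wpM2l ?exprn_ge0 ?absv_ge0 //.
have rk : 0 < rho ^+ k by rewrite exprn_gt0 // rho_gt0.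
rewrite lef_pV2 ?posrE ?abs_fact_ge //.
exact: lt_le_trans rk (abs_fact_ge k).
Qed.

Lemma abs_exp_term_le_geo z s k : a z <= s * rho -> a (exp_term z k) <= s ^+ k.
Proof.
have r0 := rho_gt0; rewrite -ler_pdivrMr // => zs.
have z0 : 0 <= a z / rho by rewrite divr_ge0 ?absv_ge0 ?ltW.
have s0 := le_trans z0 zs.
case: k => [|k]; first by rewrite /exp_term !expr0 divr1 abs1.
apply: le_trans (abs_exp_term_le z k) _; rewrite exprS ler_pM ?absv_ge0 ?exprn_ge0 //.
  by apply: le_trans zs; rewrite ler_pdivlMr // ler_piMr ?absv_ge0 ?rho_le1.
by rewrite lerXn2r ?nnegrE.
Qed.

Lemma abs_exp_term_quadratic z k : a z <= rho ->
  a (exp_term z k.+2) <= a z ^+ 2 / rho.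
Proof.
have r0 := rho_gt0; move=> zr; apply: le_trans (abs_exp_term_le z k.+1) _.
rewrite expr2 -mulrA ler_wpM2l ?absv_ge0 // exprS ler_piMr //.
  by rewrite divr_ge0 ?absv_ge0 ?ltW.
rewrite exprn_ile1 ?divr_ge0 ?absv_ge0 ?(ltW r0) //.
by rewrite ler_pdivrMr // mul1r.
Qed.

Lemma abs_quadratic_lt z : z != 0 -> a z < rho -> a z ^+ 2 / rho < a z.
Proof.
have r0 := rho_gt0; move=> z0 zr; rewrite ltr_pdivrMr // expr2 ltr_pM2l //.
by rewrite abs_gt0.
Qed.

Lemma exp_term_cvg0 z : a z < rho -> abs_cvg a (exp_term z) 0.
Proof.
have r0 := rho_gt0; move=> zr; set s := a z / rho.
have zs : a z = s * rho by rewrite divfK // gt_eqF.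
apply: (@abs_cvg_le _ _ _ (fun k => s ^+ k)) => [|k].
  apply: cvg_expr; rewrite ger0_norm; last by rewrite divr_ge0 ?absv_ge0 ?ltW.
  by rewrite ltr_pdivrMr // mul1r.
by rewrite subr0 abs_exp_term_le_geo // zs.
Qed.

Let complete : abs_complete a.
Proof. by have [] := Cp_completion C. Qed.

(** * The exponential *)

Lemma padic_exp_cvg z : a z < rho ->
  abs_cvg a (fun N => \sum_(0 <= k < N) exp_term z k) (padic_exp z).
Proof.
move=> zr; have [l ul] := abs_series_cvg abs_nat_le1 complete (exp_term_cvg0 zr).
by rewrite /padic_exp (abs_limE ul).
Qed.

Lemma padic_exp0 : padic_exp 0 = 1 :> C.
Proof.
apply: (@abs_cvg_unique _ _ a (fun N => \sum_(0 <= k < N) exp_term 0 k)).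
  by apply: padic_exp_cvg; rewrite abs0 rho_gt0.
apply/abs_cvgP => e e0; exists 1%N => -[//|N] _.
rewrite big_nat_recl // big1 ?addr0 => [|i _]; last first.
  by rewrite /exp_term expr0n mul0r.
by rewrite /exp_term expr0 divr1 subrr abs0.
Qed.

Lemma padic_exp_quadratic z : a z < rho ->
  a (padic_exp z - 1 - z) <= a z ^+ 2 / rho.
Proof.
move=> zr; rewrite -addrA -opprD; apply: (abs_cvg_ball (padic_exp_cvg zr)).
exists 2%N => -[|[|N]] // _; rewrite !big_nat_recl //.
have -> : exp_term z 0 = 1 by rewrite /exp_term expr0 divr1.
have -> : exp_term z 1 = z by rewrite /exp_term expr1 divr1.
rewrite addrA [X in a X]addrC addKr.
apply: ultra_sum => [|k _]; last exact/abs_exp_term_quadratic/ltW.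
by rewrite divr_ge0 ?exprn_ge0 ?absv_ge0 // ltW ?rho_gt0.
Qed.

Lemma abs_exp_sub1 z : a z < rho -> a (padic_exp z - 1) = a z.
Proof.
move=> zr; have [->|z0] := eqVneq z 0; first by rewrite padic_exp0 subrr.
apply: (abs_dominant abs_nat_le1); apply: le_lt_trans (padic_exp_quadratic zr) _.
exact: abs_quadratic_lt.
Qed.

Lemma padic_exp_eq1 z : a z < rho -> (padic_exp z == 1) = (z == 0).
Proof. by move=> zr; rewrite -(subr_eq0 (padic_exp z)) -!(abs_eq0 a) abs_exp_sub1. Qed.

(** The product of two partial sums differs from the partial sum at [x + y]
    by the terms of total degree at least [N], which are uniformly small. *)
Lemma padic_expD x y : a x < rho -> a y < rho ->
  padic_exp (x + y) = padic_exp x * padic_exp y.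
Proof.
move=> xr yr; have r0 := rho_gt0.
have xyr : a (x + y) < rho.
  apply: (@le_lt_trans _ _ (Num.max (a x) (a y))); last by rewrite gt_max xr.
  by apply: ultra; rewrite le_max lexx ?orbT.
set s := Num.max (a x) (a y) / rho.
have s0 : 0 <= s by rewrite divr_ge0 ?le_max ?absv_ge0 ?ltW.
have s1 : s < 1 by rewrite ltr_pdivrMr // mul1r gt_max xr.
have sr : s * rho = Num.max (a x) (a y) by rewrite divfK // gt_eqF.
pose S z N := \sum_(0 <= k < N) exp_term z k.
have lim_xy := padic_exp_cvg xyr.
have lim_prod := abs_cvgM (padic_exp_cvg xr) (padic_exp_cvg yr).
suff lim_diff : abs_cvg a (fun N => S x N * S y N - S (x + y) N) 0.
  have := abs_cvgD lim_diff lim_xy; rewrite add0r.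
  under eq_fun do rewrite subrK.
  by move=> /abs_cvg_unique; apply.
apply: (@abs_cvg_le _ _ _ (fun k => s ^+ k)) => [|N].
  by apply: cvg_expr; rewrite ger0_norm.
have -> : S (x + y) N = \sum_(0 <= i < N) \sum_(0 <= j < N | (j < N - i)%N)
    exp_term x i * exp_term y j.
  rewrite -(sum_antidiagonal (fun i j => exp_term x i * exp_term y j)).
  apply: eq_big_nat => k _; rewrite /exp_term addrC exprDn mulr_suml big_mkord.
  apply: eq_bigr => i _; have ik : (i <= k)%N by rewrite -ltnS.
  have fn j : (j`!)%:R != 0 :> C by rewrite Cp_natf_neq0 ?fact_gt0.
  rewrite -(bin_fact ik) !natrM.
  have bn : 'C(k, i)%:R != 0 :> C by rewrite Cp_natf_neq0 ?bin_gt0.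
  by rewrite -mulr_natr; field; rewrite !fn bn.
rewrite /S big_distrlr /= -sumrB subr0.
apply: ultra_sum => [|i _]; first exact: exprn_ge0.
rewrite (bigID (fun j => (j < N - i)%N)) /= addrC addrK.
apply: ultra_sum => [|j]; first exact: exprn_ge0.
rewrite -leqNgt leq_subLR => Nij; rewrite absvM.
apply: (@le_trans _ _ (s ^+ i * s ^+ j)).
  by apply: ler_pM; rewrite ?absv_ge0 // abs_exp_term_le_geo // sr le_max
    lexx ?orbT.
by rewrite -exprD ler_wiXn2l // ltW.
Qed.

Lemma padic_expMn z n : a z < rho -> padic_exp (z *+ n) = padic_exp z ^+ n.
Proof.
move=> zr; elim: n => [|n IHn]; first by rewrite mulr0n padic_exp0 expr0.
rewrite mulrS padic_expD ?IHn ?exprS // -mulr_natr absvM.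
by apply: le_lt_trans zr; rewrite ler_piMr ?absv_ge0 ?abs_nat_le1.
Qed.

Lemma abs_exp z : a z < rho -> a (padic_exp z) = 1.
Proof.
move=> zr; rewrite -(abs1 a); apply: (abs_dominant abs_nat_le1).
by rewrite abs_exp_sub1 // abs1 (lt_le_trans zr) ?rho_le1.
Qed.

(** The exponential has derivative one at the origin, computed along the
    sequence [p ^ n * z]. *)
Lemma padic_exp_slope z : a z < rho ->
  abs_cvg a (fun n => (padic_exp (z * (p ^ n)%:R) - 1) / (p ^ n)%:R) z.
Proof.
move=> zr; apply: (@abs_cvg_le _ _ _ (fun n => P ^- n * (a z ^+ 2 / rho))).
  exact: abs_expp_cvg0.
move=> n; have pn := expp_neq0 n.
have zpr : a (z * (p ^ n)%:R) < rho.
  apply: le_lt_trans zr; rewrite absvM.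
  by rewrite ler_piMr ?absv_ge0 ?abs_nat_le1.
have -> : (padic_exp (z * (p ^ n)%:R) - 1) / (p ^ n)%:R - z =
  (padic_exp (z * (p ^ n)%:R) - 1 - z * (p ^ n)%:R) / (p ^ n)%:R.
  by field.
rewrite absvM absV ler_pdivrMr ?abs_gt0 //.
apply: le_trans (padic_exp_quadratic zpr) _; rewrite absvM abs_expp le_eqVlt.
by apply/orP; left; apply/eqP; ring.
Qed.

(** * The logarithm *)

(** As [p ^ n] tends to zero, [C(p ^ n - 1, k)] tends to
    [C(-1, k) = (-1) ^ k].  Pascal's rule reduces the estimate to one for
    [C(p ^ n, k)], and [k * C(p ^ n, k)] is a multiple of [p ^ n]. *)
Lemma abs_bin_pred_expp n k :
  a ('C((p ^ n).-1, k)%:R - (-1) ^+ k) <= P ^- n * k%:R.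
Proof.
elim: k => [|k IHk]; first by rewrite bin0 subrr abs0 mulr0.
have pn0 : (0 < p ^ n)%N by rewrite expn_gt0 prime_gt0.
have -> : 'C((p ^ n).-1, k.+1)%:R - (-1) ^+ k.+1 =
    'C(p ^ n, k.+1)%:R - ('C((p ^ n).-1, k)%:R - (-1) ^+ k) :> C.
  rewrite -{2}(prednK pn0) binS natrD exprS; ring.
have Pn0 : 0 <= P ^- n by rewrite invr_ge0 exprn_ge0 ?ltW.
apply: ultra; last first.
  by rewrite absN (le_trans IHk) // ler_wpM2l // ler_nat.
have := congr1 (fun m => a m%:R) (mul_bin_diag (p ^ n) k).
rewrite !natrM !absvM abs_expp => bin_eq.
rewrite -ler_pdivrMr ?ltr0n //.
apply: (@le_trans _ _ (a 'C(p ^ n, k.+1)%:R * a k.+1%:R)).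
  by rewrite ler_wpM2l ?absv_ge0 ?abs_nat_ge.
by rewrite mulrC -bin_eq ler_piMr ?abs_nat_le1.
Qed.

Definition log_term (x : C) k : C := (-1) ^+ k.+1 * x ^+ k / k%:R.

Lemma abs_pow_div_le x k : a (x ^+ k / k%:R) <= a (exp_term x k).
Proof.
case: k => [|k]; first by rewrite invr0 mulr0 abs0 absv_ge0.
rewrite /exp_term !absvM !absV ler_wpM2l ?absv_ge0 // lef_pV2 ?posrE ?abs_gt0
  ?Cp_natf_neq0 ?fact_gt0 //.
by rewrite factS natrM absvM ler_piMr ?absv_ge0 ?abs_nat_le1.
Qed.

Lemma abs_log_term_le x k : a (log_term x k) <= a (exp_term x k).
Proof.
apply: le_trans (abs_pow_div_le x k).
by rewrite /log_term -mulrA absvM absX absN1 expr1n mul1r.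
Qed.

Lemma padic_log_cvg Q : a (Q - 1) < rho ->
  abs_cvg a (fun N => \sum_(1 <= k < N) log_term (Q - 1) k) (padic_log Q).
Proof.
move=> Qr.
have t0 : abs_cvg a (log_term (Q - 1)) 0.
  have e0 := exp_term_cvg0 Qr.
  apply: (@abs_cvg_le _ _ _ (fun k => a (exp_term (Q - 1) k - 0))) => // k.
  by rewrite !subr0 abs_log_term_le.
have [l ul] := abs_series_cvg abs_nat_le1 complete t0.
suff ul1 : abs_cvg a (fun N => \sum_(1 <= k < N) log_term (Q - 1) k) l.
  by rewrite /padic_log (abs_limE ul1).
move: ul; congr (abs_cvg a _ l); apply/funext => -[|N]; first by rewrite !big_geq.
by rewrite big_ltn // {1}/log_term invr0 mulr0 add0r.
Qed.

(** The linear term of the logarithmic series dominates. *)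
Lemma abs_padic_log Q : a (Q - 1) < rho -> a (padic_log Q) = a (Q - 1).
Proof.
move=> Qr; have [Q1|Q1] := eqVneq (Q - 1) 0.
  rewrite Q1; congr (a _).
  apply: (abs_cvg_unique (padic_log_cvg Qr)); rewrite Q1.
  under eq_fun => N.
    rewrite big_nat big1 => [|k /andP[k0 _]]; last first.
      by rewrite /log_term expr0n gtn_eqF // mulr0 mul0r.
    over.
  exact: abs_cvg_cst.
apply: (abs_dominant abs_nat_le1).
apply: le_lt_trans (abs_quadratic_lt Q1 Qr).
apply: (abs_cvg_ball (padic_log_cvg Qr)).
exists 2%N => -[|[|N]] // _; rewrite big_ltn //.
have -> : log_term (Q - 1) 1 = Q - 1 by rewrite /log_term sqrrN !expr1n mul1r divr1.
rewrite addrC addKr big_nat; apply: ultra_sum => [|k /andP[k2 _]].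
  by rewrite divr_ge0 ?exprn_ge0 ?absv_ge0 // ltW ?rho_gt0.
apply: le_trans (abs_log_term_le _ _) _; case: k k2 => [|[|k]] // _.
exact/abs_exp_term_quadratic/ltW.
Qed.

(** The logarithm is the derivative at zero of [Q ^ s]: by the binomial
    theorem the quotient [(Q ^+ (p ^ n) - 1) / p ^ n] has the coefficients
    [C(p^n - 1, k - 1) / k], which tend to those of the logarithmic series. *)
Lemma padic_log_slope Q : a (Q - 1) < rho ->
  abs_cvg a (fun n => (Q ^+ (p ^ n) - 1) / (p ^ n)%:R) (padic_log Q).
Proof.
move=> Qr; set x := Q - 1; have r0 := rho_gt0.
set s := a x / rho.
have s0 : 0 <= s by rewrite divr_ge0 ?absv_ge0 ?ltW.
have s1 : s < 1 by rewrite ltr_pdivrMr // mul1r.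
(* The factor [k] lost in the estimate of the coefficients is absorbed by
   [s ^+ k], since [k * s ^+ k <= 1 + s + s ^+ 2 + ...]. *)
have geo k : k%:R * s ^+ k <= (1 - s)^-1.
  rewrite -[leRHS]mul1r ler_pdivlMr ?subr_gt0 //.
  apply: (@le_trans _ _ (1 - s ^+ k)); last by rewrite gerBl exprn_ge0.
  have -> : 1 - s ^+ k = (1 - s) * \sum_(i < k) s ^+ i.
    by rewrite -opprB subrX1 -mulNr opprB.
  rewrite mulrC ler_wpM2l ?subr_ge0 ?(ltW s1) //.
  have -> : k%:R * s ^+ k = \sum_(i < k) s ^+ k.
    by rewrite sumr_const card_ord mulr_natl.
  by apply: ler_sum => i _; rewrite ler_wiXn2l ?(ltW s1) // ltnW.
pose D n := (Q ^+ (p ^ n) - 1) / (p ^ n)%:R -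
  \sum_(1 <= k < (p ^ n).+1) log_term x k.
have D0 : abs_cvg a D 0.
  apply: (@abs_cvg_le _ _ _ (fun n => P ^- n * (1 - s)^-1)).
    exact: abs_expp_cvg0.
  move=> n; rewrite subr0 /D; have pn := expp_neq0 n.
  have -> : (Q ^+ (p ^ n) - 1) / (p ^ n)%:R =
      \sum_(1 <= k < (p ^ n).+1) 'C((p ^ n).-1, k.-1)%:R * (x ^+ k / k%:R).
    have -> : Q = x + 1 by rewrite subrK.
    rewrite exprD1n -(big_mkord predT (fun i => x ^+ i *+ 'C(p ^ n, i))).
    rewrite big_ltn // expr0 bin0 [1 *+ _]mulr1n addrAC subrr add0r mulr_suml.
    apply: eq_big_nat => -[|k] //= _.
    have k0 : k.+1%:R != 0 :> C by rewrite Cp_natf_neq0.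
    have := congr1 (fun m => m%:R : C) (mul_bin_diag (p ^ n) k).
    rewrite !natrM /= => bin_eq; rewrite -mulr_natr.
    apply: (mulIf pn); rewrite divfK //; apply: (mulIf k0).
    have -> : x ^+ k.+1 * 'C(p ^ n, k.+1)%:R * k.+1%:R =
      x ^+ k.+1 * (k.+1%:R * 'C(p ^ n, k.+1)%:R) by ring.
    by rewrite -bin_eq; field; rewrite nat1r.
  rewrite -sumrB big_nat; apply: ultra_sum => [|k /andP[k0 _]].
    by rewrite mulr_ge0 ?invr_ge0 ?exprn_ge0 ?subr_ge0 ?ltW.
  have -> : 'C((p ^ n).-1, k.-1)%:R * (x ^+ k / k%:R) - log_term x k =
      ('C((p ^ n).-1, k.-1)%:R - (-1) ^+ k.-1) * (x ^+ k / k%:R).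
    case: k k0 => // k _; rewrite /log_term /= !exprS; ring.
  rewrite absvM.
  apply: (@le_trans _ _ (P ^- n * k%:R * s ^+ k)).
    apply: ler_pM; rewrite ?absv_ge0 //.
      apply: le_trans (abs_bin_pred_expp _ _) _.
      by rewrite ler_wpM2l ?invr_ge0 ?exprn_ge0 ?(ltW P_gt0) // ler_nat leq_pred.
    apply: le_trans (abs_pow_div_le _ _) _.
    by rewrite abs_exp_term_le_geo // divfK // gt_eqF.
  by rewrite -mulrA ler_wpM2l ?invr_ge0 ?exprn_ge0 ?(ltW P_gt0).
have L0 : abs_cvg a (fun n => \sum_(1 <= k < (p ^ n).+1) log_term x k) (padic_log Q).
  have /abs_cvgP logQ := padic_log_cvg Qr; apply/abs_cvgP => e e0.
  have [N HN] := logQ e e0; exists N => n Nn; apply: HN; apply: leq_trans Nn _.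
  by apply/ltnW/leqW/ltn_expl/prime_gt1.
have := abs_cvgD D0 L0; rewrite add0r; congr (abs_cvg a _ _).
by apply/funext => n; rewrite subrK.
Qed.

Lemma padic_log_exp z : a z < rho -> padic_log (padic_exp z) = z.
Proof.
move=> zr; have ezr : a (padic_exp z - 1) < rho by rewrite abs_exp_sub1.
apply: (abs_cvg_unique (padic_log_slope ezr)).
move: (padic_exp_slope zr); congr (abs_cvg a _ z); apply/funext => n.
by rewrite mulr_natr padic_expMn.
Qed.

Lemma qpow_exp t z : a t < rho -> qpow (padic_exp t) z = padic_exp (z * t).
Proof. by move=> tr; rewrite /qpow padic_log_exp. Qed.

(** * Volkenborn integrals of exponentials *)

Lemma padic_int_CpB x y : padic_int_Cp x - padic_int_Cp y =
  Qpbar_Cp C (Qp_Qpbar C (sval x - sval y)).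
Proof. by rewrite !rmorphB. Qed.

Lemma abs_padic_int_CpB x y :
  a (padic_int_Cp x - padic_int_Cp y) = absQp C (sval x - sval y).
Proof.
have [isoC _ _] := Cp_completion C.
by rewrite padic_int_CpB isoC Qpbar_isometric.
Qed.

Lemma abs_padic_int_Cp_le1 y : a (@padic_int_Cp _ _ C y) <= 1.
Proof. by rewrite abs_padic_int_Cp; case: y. Qed.

Lemma padic_int_Cp_nat n : padic_int_Cp (nat_padic_int C n) = n%:R.
Proof. by rewrite /padic_int_Cp /= !rmorph_nat. Qed.

Lemma abs_scale_lt c z : a c < rho -> a z <= 1 -> a (c * z) < rho.
Proof.
by move=> cr z1; apply: le_lt_trans cr; rewrite absvM ler_piMr ?absv_ge0.
Qed.

(** With [d = x - y] the difference quotient is [e(c y) * ((e(c d) - 1) / d)],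
    and [|e(c d) - 1 - c d| <= |c d| ^ 2 / rho <= |d| ^ 2] as [|c| < rho <= 1]. *)
Lemma uniformly_differentiable_exp c : a c < rho ->
  uniformly_differentiable (fun y => padic_exp (c * padic_int_Cp y) : C).
Proof.
move=> cr b; have r0 := rho_gt0; have r1 := rho_le1.
exists (c * padic_exp (c * padic_int_Cp b)) => e e0; exists e => // x y xb yb xy.
set X := padic_int_Cp x; set Y := padic_int_Cp y; set B := padic_int_Cp b.
have le1 := abs_padic_int_Cp_le1.
have XB : a (X - B) < e by rewrite abs_padic_int_CpB.
have YB : a (Y - B) < e by rewrite abs_padic_int_CpB.
have XY0 : X - Y != 0.
  by rewrite -(abs_eq0 a) abs_padic_int_CpB gt_eqF // abs_gt0 subr_eq0.
set M := Num.max (a (X - B)) (a (Y - B)).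
have Me : M < e by rewrite gt_max XB.
have XY : a (X - Y) <= M.
  rewrite -(subrK B X) -addrA; apply: ultra; first by rewrite le_max lexx.
  by rewrite absB le_max lexx orbT.
have X1 : a X <= 1 := le1 x.
have Y1 : a Y <= 1 := le1 y.
have B1 : a B <= 1 := le1 b.
have cY : a (c * Y) < rho := abs_scale_lt cr Y1.
have cB : a (c * B) < rho := abs_scale_lt cr B1.
have cXY : a (c * (X - Y)) < rho.
  by apply: abs_scale_lt => //; apply: ultra; rewrite ?absN.
have cYB : a (c * (Y - B)) < rho.
  by apply: abs_scale_lt => //; apply: ultra; rewrite ?absN.
have expX : padic_exp (c * X) = padic_exp (c * Y) * padic_exp (c * (X - Y)).
  by rewrite -padic_expD //; congr padic_exp; ring.
have expY : padic_exp (c * Y) = padic_exp (c * B) * padic_exp (c * (Y - B)).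
  by rewrite -padic_expD //; congr padic_exp; ring.
have -> : (padic_exp (c * X) - padic_exp (c * Y)) / (X - Y) - c * padic_exp (c * B) =
   padic_exp (c * Y) * ((padic_exp (c * (X - Y)) - 1 - c * (X - Y)) / (X - Y))
   + c * padic_exp (c * B) * (padic_exp (c * (Y - B)) - 1).
  rewrite expX [in RHS]expY; rewrite {1 2}expY; field; exact: XY0.
have c1 : a c <= 1 by exact: le_trans (ltW cr) r1.
apply: le_lt_trans Me; apply: ultra; last first.
  rewrite !absvM abs_exp // abs_exp_sub1 // mulr1 absvM.
  apply: (@le_trans _ _ (a (Y - B))); last by rewrite le_max lexx orbT.
  by rewrite mulrA ler_piMl ?absv_ge0 // mulr_ile1 ?absv_ge0.
rewrite absvM abs_exp // mul1r absvM absV.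
rewrite ler_pdivrMr ?abs_gt0 //.
apply: le_trans (padic_exp_quadratic cXY) _.
rewrite ler_pdivrMr // absvM.
have c0 := absv_ge0 a c; have XY_ge0 := absv_ge0 a (X - Y).
have cc : a c * a c <= rho by apply: le_trans (ltW cr); rewrite ler_piMr.
have -> : (a c * a (X - Y)) ^+ 2 = (a c * a c) * (a (X - Y) * a (X - Y)) by ring.
by rewrite [leRHS]mulrC ler_pM ?mulr_ge0 // ler_wpM2r.
Qed.

Lemma is_volkenborn_sum (I : finType) Q (A : I -> C) (f : I -> padic_int C -> C)
    (J : I -> C) : (forall k, is_volkenborn Q (f k) (J k)) ->
  is_volkenborn Q (fun y => \sum_k A k * f k y) (\sum_k A k * J k).
Proof.
move=> fJ; split; last first.
  have := abs_cvg_sum (fun k => abs_cvgMl (A k) (proj2 (fJ k))).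
  congr (abs_cvg a _ _); apply/funext => N.
  under eq_bigr do rewrite mulrCA.
  rewrite -mulr_sumr; congr (_ * _).
  under eq_bigr do rewrite mulr_sumr.
  rewrite exchange_big /=; apply: eq_bigr => y _.
  by rewrite mulr_suml; apply: eq_bigr => k _; rewrite mulrA.
move=> b; pose dq (f : padic_int C -> C) x y :=
  (f x - f y) / (padic_int_Cp x - padic_int_Cp y).
elim: (index_enum I) => [|i s [l IHl]].
  exists 0 => e e0; exists 1 => // x y _ _ _.
  by rewrite !big_nil subrr mul0r subrr abs0.
have [m fm] := (proj1 (fJ i)) b.
exists (A i * m + l) => e e0.
(* Adding [1] to [|A i|] keeps the divisor positive when [A i = 0]. *)
pose e' := e / (1 + a (A i)).
have A1 : 0 < 1 + a (A i) by rewrite ltr_wpDr ?absv_ge0.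
have [d1 d10 fd1] := fm e' (divr_gt0 e0 A1); have [d2 d20 fd2] := IHl e e0.
exists (Num.min d1 d2); first by rewrite lt_min d10.
move=> x y; rewrite !lt_min => /andP[x1 x2] /andP[y1 y2] xy.
rewrite !big_cons.
have := fd1 x y x1 y1 xy; have := fd2 x y x2 y2 xy.
set dxy := padic_int_Cp x - _; set sx := \sum_(j <- s) _; set sy := \sum_(j <- s) _.
move=> h2 h1.
have -> : (A i * f i x + sx - (A i * f i y + sy)) / dxy - (A i * m + l) =
  A i * ((f i x - f i y) / dxy - m) + ((sx - sy) / dxy - l) by ring.
have h3 : a (A i * ((f i x - f i y) / dxy - m)) < e.
  move: h1; rewrite absvM /e' ltr_pdivlMr // => h1; apply: le_lt_trans h1.
  by rewrite mulrC ler_wpM2l ?absv_ge0 // lerDr.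
apply: (@le_lt_trans _ _ (Num.max (a (A i * ((f i x - f i y) / dxy - m)))
  (a ((sx - sy) / dxy - l)))); last by rewrite gt_max h3.
by apply: ultra; rewrite le_max lexx ?orbT.
Qed.

Lemma volkenbornE Q f I : is_volkenborn Q f I -> volkenborn Q f = I :> C.
Proof.
move=> fI; apply: xget_unique => // J [_ fJ].
exact: abs_cvg_unique fJ (proj2 fI).
Qed.

(** The generating function of the Bernoulli numbers, [u / (exp u - 1)]. *)
Definition bernoulli_gf (u : C) : C :=
  if u == 0 then 1 else u / (padic_exp u - 1).

(** The Volkenborn sums of an exponential are geometric, and their quotients by
    [p ^ N] tend to a derivative of the exponential at the origin. *)
Lemma is_volkenborn_exp t c : t != 0 -> a t < rho -> a c < rho ->
  is_volkenborn (padic_exp t) (fun y => padic_exp (c * padic_int_Cp y))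
    ((padic_exp t - 1) / t * bernoulli_gf (c + t)).
Proof.
move=> t0 tr cr; split; first exact: uniformly_differentiable_exp.
set u := c + t; have ur : a u < rho.
  apply: (@le_lt_trans _ _ (Num.max (a c) (a t))); last by rewrite gt_max cr.
  by apply: ultra; rewrite le_max lexx ?orbT.
have sum_lim : abs_cvg a (fun N =>
    (\sum_(0 <= y < p ^ N) padic_exp u ^+ y) / (p ^ N)%:R) (bernoulli_gf u).
  rewrite /bernoulli_gf; have [u0|u0] := eqVneq u 0.
    have -> : (fun N => (\sum_(0 <= y < p ^ N) padic_exp u ^+ y) / (p ^ N)%:R) =
        (fun=> 1); last exact: abs_cvg_cst.
    apply/funext => N; rewrite u0 padic_exp0.
    under eq_bigr do rewrite expr1n.
    by rewrite big_const_nat iter_addr_0 subn0 divff ?expp_neq0.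
  have := abs_cvgMl (padic_exp u - 1)^-1 (padic_exp_slope ur).
  rewrite mulrC; congr (abs_cvg a _ _); apply/funext => N.
  rewrite mulr_natr padic_expMn // subrX1 big_mkord.
  have e0 : padic_exp u - 1 != 0 by rewrite subr_eq0 padic_exp_eq1.
  by rewrite -[_ / _ in LHS]mulrA mulKf.
have inv_lim : abs_cvg a
    (fun N => ((padic_exp (t * (p ^ N)%:R) - 1) / (p ^ N)%:R)^-1) t^-1.
  apply: (abs_cvgV t0 (padic_exp_slope tr)) => N.
  rewrite absvM absV abs_exp_sub1 ?abs_scale_lt ?abs_nat_le1 // absvM mulfK //.
  by rewrite abs_eq0 expp_neq0.
have := abs_cvgM (abs_cvgMl (padic_exp t - 1) inv_lim) sum_lim.
congr (abs_cvg a _ _); apply/funext => N.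
have pN := expp_neq0 N.
have tN0 : padic_exp (t * (p ^ N)%:R) - 1 != 0.
  by rewrite subr_eq0 padic_exp_eq1 ?abs_scale_lt ?abs_nat_le1 // mulf_neq0.
have -> : \sum_(0 <= y < p ^ N) padic_exp (c * padic_int_Cp (nat_padic_int C y))
    * qpow (padic_exp t) y%:R = \sum_(0 <= y < p ^ N) padic_exp u ^+ y.
  apply: eq_bigr => y _.
  rewrite qpow_exp // padic_int_Cp_nat [_ * t]mulrC -padic_expD ?abs_scale_lt
    ?abs_nat_le1 //.
  by rewrite -mulrDl mulr_natr padic_expMn.
rewrite /qnum qpow_exp // [_ * t]mulrC.
have tN0' : 1 - padic_exp (t * (p ^ N)%:R) != 0 by rewrite -opprB oppr_eq0.
have t10 : 1 - padic_exp t != 0 by rewrite subr_eq0 eq_sym padic_exp_eq1.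
by field; rewrite pN t10 tN0 tN0'.
Qed.

(** Integrating over all variables but the last turns every product into an
    exponential of the last variable, so the induction generalizes over the
    coefficients [A]. *)
Lemma volkenborn_iter_exp t (I : finType) (A : I -> C) (c : I -> nat -> C) r :
  t != 0 -> a t < rho -> (forall k l, a (c k l) < rho) ->
  volkenborn_iter (padic_exp t) (fun ys : r.-tuple (padic_int C) =>
    \sum_k A k * \prod_(l < r) padic_exp (c k l * padic_int_Cp (tnth ys l))) =
  \sum_k A k * \prod_(l < r) ((padic_exp t - 1) / t * bernoulli_gf (c k l + t)).
Proof.
move=> t0 tr cr; elim: r A => [|r IHr] A /=.
  by apply: eq_bigr => k _; rewrite !big_ord0.
have step : (fun y => volkenborn_iter (padic_exp t)
    (fun ys : r.-tuple (padic_int C) => \sum_k A k * \prod_(l < r.+1)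
      padic_exp (c k l * padic_int_Cp (tnth [tuple of rcons ys y] l)))) =
  (fun y => \sum_k A k * (\prod_(l < r)
     ((padic_exp t - 1) / t * bernoulli_gf (c k l + t)))
     * padic_exp (c k r * padic_int_Cp y)).
  apply/funext => y.
  transitivity (volkenborn_iter (padic_exp t)
    (fun ys : r.-tuple (padic_int C) =>
       \sum_k A k * padic_exp (c k r * padic_int_Cp y) *
       \prod_(l < r) padic_exp (c k l * padic_int_Cp (tnth ys l)))).
    congr (volkenborn_iter _ _); apply/funext => ys; apply: eq_bigr => k _.
    rewrite big_ord_recr /= mulrA mulrAC; congr (_ * _ * _).
      by rewrite (tnth_nth y) /= nth_rcons size_tuple ltnn eqxx.
    apply: eq_bigr => l _.
    by rewrite !(tnth_nth y) /= nth_rcons size_tuple ltn_ord.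
  by rewrite IHr; apply: eq_bigr => k _; rewrite mulrAC.
rewrite step.
have /volkenbornE -> := is_volkenborn_sum (fun k => A k * \prod_(l < r)
  ((padic_exp t - 1) / t * bernoulli_gf (c k l + t)))
  (fun k => is_volkenborn_exp t0 tr (cr k r)).
by apply: eq_bigr => k _; rewrite big_ord_recr /= [RHS]mulrA.
Qed.

(** * The two sides of the identity *)

Lemma abs_sum_lt (I : Type) (s : seq I) (F : I -> C) B :
  0 < B -> (forall i, a (F i) < B) -> a (\sum_(i <- s) F i) < B.
Proof.
move=> B0 FB; elim/big_ind: _ => //; first by rewrite abs0.
move=> x y xB yB; apply: (@le_lt_trans _ _ (Num.max (a x) (a y))).
  by apply: ultra; rewrite le_max lexx ?orbT.
by rewrite gt_max xB.
Qed.

Lemma padic_exp_sum (I : Type) (s : seq I) (F : I -> C) :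
  (forall i, a (F i) < rho) ->
  padic_exp (\sum_(i <- s) F i) = \prod_(i <- s) padic_exp (F i).
Proof.
move=> Fr; elim: s => [|i s IHs]; first by rewrite !big_nil padic_exp0.
by rewrite !big_cons padic_expD ?IHs // abs_sum_lt // rho_gt0.
Qed.

(** Each term of the binomial expansion of [[z + y_1 + ... + y_r]_Q ^ n] is a
    product of exponentials [e((k + h - l) t y_l)], where [l] runs from [1] to
    [r]; the density [Q ^ y_l] of the measure raises the exponent by one, which
    makes it [k + h - l] for the index [l] counted from [0]. *)
Lemma qbeta_exp h r n t z : t != 0 -> a t < rho -> a z <= 1 ->
  qbeta h r n (padic_exp t) z =
  (1 - padic_exp t) ^- n * \sum_(k < n.+1) 'C(n, k)%:R *
    ((-1) ^+ k * padic_exp (k%:R * z * t) *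
     \prod_(l < r) ((padic_exp t - 1) / t *
                    bernoulli_gf ((k%:Z + h - l%:Z)%:~R * t))).
Proof.
move=> t0 tr z1.
pose c (k : 'I_n.+1) l : C := (k%:Z + h - l.+1%:Z)%:~R * t.
pose A (k : 'I_n.+1) : C :=
  (1 - padic_exp t) ^- n * 'C(n, k)%:R * ((-1) ^+ k * padic_exp (k%:R * z * t)).
have int_r (m : int) : a (m%:~R * t) < rho.
  by rewrite mulrC abs_scale_lt // (abs_int_le1 abs_nat_le1).
have cr k l : a (c k l) < rho by exact: int_r.
transitivity (volkenborn_iter (padic_exp t) (fun ys : r.-tuple (padic_int C) =>
    \sum_k A k * \prod_(l < r) padic_exp (c k l * padic_int_Cp (tnth ys l)))).
  rewrite /qbeta; congr (volkenborn_iter _ _); apply/funext => ys.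
  set S := \sum_(l < r) padic_int_Cp (tnth ys l); set S' := \sum_(l < r) _.
  have S1 : a S <= 1.
    by apply: ultra_sum => // l _; apply: abs_padic_int_Cp_le1.
  have S'1 : a S' <= 1.
    apply: ultra_sum => // l _; rewrite absvM mulr_ile1 ?absv_ge0 //.
      exact: abs_int_le1 abs_nat_le1 _.
    exact: abs_padic_int_Cp_le1.
  have zS : a (z + S) <= 1 by exact: ultra.
  have scale y : a y <= 1 -> a (y * t) < rho by move=> y1; rewrite mulrC abs_scale_lt.
  rewrite /qnum !qpow_exp // expr_div_n exprBn mulrAC mulr_suml mulrC mulr_sumr.
  apply: eq_bigr => k _; rewrite expr1n mulr1 -mulr_natr.
  rewrite -padic_expMn ?scale //.
  have k1 : a k%:R <= 1 by exact: abs_nat_le1.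
  have kz1 : a (k%:R * z) <= 1 by rewrite absvM mulr_ile1 ?absv_ge0.
  have -> : \prod_(l < r) padic_exp (c k l * padic_int_Cp (tnth ys l)) =
      padic_exp (((z + S) * t) *+ k - k%:R * z * t + S' * t).
    rewrite -padic_exp_sum => [|l]; last first.
      by rewrite abs_scale_lt // abs_padic_int_Cp_le1.
    congr padic_exp.
    have -> : (z + S) * t *+ k - k%:R * z * t + S' * t = (k%:R * S + S') * t.
      rewrite -mulr_natr; ring.
    rewrite /S /S' mulr_sumr -big_split /= mulr_suml; apply: eq_bigr => l _.
    by rewrite /c !rmorphB !rmorphD /=; ring.
  have kzt := scale _ kz1.
  have zSk : a ((z + S) * t *+ k) < rho.
    by rewrite -mulr_natr abs_scale_lt // scale.
  have dr : a ((z + S) * t *+ k - k%:R * z * t) < rho.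
    have -> : (z + S) * t *+ k - k%:R * z * t = k%:R * S * t.
      rewrite -mulr_natr; ring.
    by apply: scale; rewrite absvM mulr_ile1 ?absv_ge0.
  rewrite padic_expD ?scale // /A.
  have -> : padic_exp (((z + S) * t) *+ k) = padic_exp (k%:R * z * t) *
      padic_exp (((z + S) * t) *+ k - k%:R * z * t).
    by rewrite -padic_expD // [k%:R * z * t + _]addrC subrK.
  ring.
rewrite volkenborn_iter_exp // mulr_sumr; apply: eq_bigr => k _.
rewrite /A -!mulrA; do 4![congr (_ * _)]; apply: eq_bigr => l _.
congr (_ * bernoulli_gf _); rewrite /c -[in X in _ + X](mul1r t) -mulrDl.
by congr (_ * t); rewrite intS !rmorphB !rmorphD /=; ring.
Qed.

(** The part [i * (j_1 + ... + j_r)] of the exponent is split off, as it is the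
    power [u ^ i] of the umbral binomial formula below. *)
Lemma qT_exp h r n i w t : a t < rho ->
  qT h r n i w (padic_exp t) =
  (1 - padic_exp t) ^- (n - i) * \sum_(j : {ffun 'I_r -> 'I_w})
    (1 - padic_exp t ^+ (\sum_l j l)) ^+ (n - i) *
    (padic_exp t ^+ (\sum_l j l)) ^+ i *
    \prod_(l < r) padic_exp ((h - l%:Z)%:~R * t) ^+ j l.
Proof.
move=> tr; rewrite /qT mulr_sumr; apply: eq_bigr => j _.
have int_r (m : int) : a (m%:~R * t) < rho.
  by rewrite mulrC abs_scale_lt // (abs_int_le1 abs_nat_le1).
rewrite /qnum !qpow_exp // expr_div_n mulrAC mulrC -!mulrA.
rewrite mulr_natl padic_expMn //; do 2![congr (_ * _)].
transitivity (padic_exp (\sum_(l < r) (((h - l%:Z)%:~R * t) *+ j l + t *+ (j l * i)))).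
  congr padic_exp; rewrite rmorph_sum mulr_suml; apply: eq_bigr => l _ /=.
  have -> : h + i%:Z - l.+1%:Z + 1 = (h - l%:Z) + i%:Z by rewrite intS; ring.
  rewrite intrM intrD; set m := (h - l%:Z)%:~R.
  by rewrite -[m * t *+ _]mulr_natr -[t *+ _]mulr_natr natrM; ring.
have nat_r (x : C) m : a x < rho -> a (x *+ m) < rho.
  by move=> xr; rewrite -mulr_natr abs_scale_lt ?abs_nat_le1.
rewrite big_split padic_expD /=; last 2 first.
- by apply: abs_sum_lt => [|l]; rewrite ?rho_gt0 ?nat_r.
- by apply: abs_sum_lt => [|l]; rewrite ?rho_gt0 ?nat_r.
rewrite mulrC !padic_exp_sum => [|l|l]; rewrite ?nat_r //.
congr (_ * _); last by apply: eq_bigr => l _; rewrite padic_expMn.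
rewrite -exprM big_distrl /= -prodrXr /=; apply: eq_bigr => l _.
by rewrite padic_expMn.
Qed.

(** Umbral form of [(x + y * f) ^+ n], the powers of [f] being lowered to
    values of the sequence [f]. *)
Definition umbral_pow (x y : C) n (f : nat -> C) : C :=
  \sum_(i < n.+1) 'C(n, i)%:R * x ^+ (n - i) * y ^+ i * f i.

Lemma umbral_powS x y n f : umbral_pow x y n.+1 f =
  x * umbral_pow x y n f + y * umbral_pow x y n (fun i => f i.+1).
Proof.
have -> : x * umbral_pow x y n f =
    \sum_(i < n.+2) 'C(n, i)%:R * x ^+ (n.+1 - i) * y ^+ i * f i.
  rewrite [RHS]big_ord_recr /= bin_small // !mul0r addr0 mulr_sumr.
  apply: eq_bigr => i _; rewrite subSn -1?ltnS // exprS; ring.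
rewrite {1}/umbral_pow big_ord_recl [in RHS]big_ord_recl /= !bin0 -addrA.
rewrite /umbral_pow mulr_sumr -big_split /=.
congr (_ + _); apply: eq_bigr => i _.
by rewrite /bump /= add1n binS natrD subSS exprS; ring.
Qed.

Lemma umbral_powD x y n f g : umbral_pow x y n (fun i => f i + g i) =
  umbral_pow x y n f + umbral_pow x y n g.
Proof.
by rewrite /umbral_pow -big_split; apply: eq_bigr => i _; rewrite mulrDr.
Qed.

(** This is [((1 - u) + u * (1 + f)) ^+ n = (1 + u * f) ^+ n]. *)
Lemma umbral_pow_comp u n f :
  umbral_pow (1 - u) u n (fun i => umbral_pow 1 1 i f) = umbral_pow 1 u n f.
Proof.
elim: n f => [|n IHn] f; first by rewrite /umbral_pow !big_ord1 /= bin0 !expr0 !mul1r.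
rewrite !umbral_powS IHn.
have -> : (fun i => umbral_pow 1 1 i.+1 f) =
    (fun i => umbral_pow 1 1 i f + umbral_pow 1 1 i (fun k => f k.+1)).
  by apply/funext => i; rewrite umbral_powS !mul1r.
by rewrite umbral_powD !IHn; ring.
Qed.

Definition symmetric_factor (w1 w2 : nat) (u : C) : C :=
  bernoulli_gf (w1%:R * u) / w1%:R * \sum_(j < w1) padic_exp (w2%:R * u) ^+ j.

(** For [u != 0] the factor is [u * (exp (w1 * w2 * u) - 1)] divided by
    [(exp (w1 * u) - 1) * (exp (w2 * u) - 1)]. *)
Lemma symmetric_factorC w1 w2 u : (0 < w1)%N -> (0 < w2)%N -> a u < rho ->
  symmetric_factor w1 w2 u = symmetric_factor w2 w1 u.
Proof.
move=> w10 w20 ur; rewrite /symmetric_factor /bernoulli_gf.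
have nz w : (0 < w)%N -> w%:R != 0 :> C by exact: Cp_natf_neq0.
have [->|u0] := eqVneq u 0.
  rewrite !mulr0 eqxx padic_exp0.
  under eq_bigr do rewrite expr1n.
  under [in RHS]eq_bigr do rewrite expr1n.
  by rewrite !sumr_const !card_ord !div1r !mulVf ?nz.
have wur w : a (w%:R * u) < rho by rewrite mulrC abs_scale_lt ?abs_nat_le1.
have wu0 w : (0 < w)%N -> w%:R * u != 0 by move=> w0; rewrite mulf_neq0 ?nz.
have ew w : (0 < w)%N -> padic_exp (w%:R * u) - 1 != 0.
  by move=> w0; rewrite subr_eq0 padic_exp_eq1 ?wu0.
rewrite !ifN ?wu0 //.
have geo v w : (0 < v)%N -> \sum_(j < w) padic_exp (v%:R * u) ^+ j =
    (padic_exp (u *+ (v * w)) - 1) / (padic_exp (v%:R * u) - 1).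
  move=> v0; apply: (mulfI (ew v v0)).
  by rewrite -subrX1 mulrCA divff ?ew // mulr1 -padic_expMn // mulrnA mulr_natl.
by rewrite !geo // [(w2 * w1)%N]mulnC; field; rewrite !nz ?ew.
Qed.

(** One side of the identity, with the integrals evaluated, the finite sum over
    [j] turned into a product of geometric sums, and the sum over [i] contracted
    by [umbral_pow_comp]. *)
Lemma one_side_eq n h r w1 w2 (q x : C) :
  (0 < w1)%N -> (0 < w2)%N -> q != 1 -> a (q - 1) < rho -> a x <= 1 ->
  \sum_(i < n.+1) ('C(n, i))%:R * qnum q w2%:R ^+ (n - i)
      * qnum q w1%:R ^ (i%:Z - r%:Z)
      * qbeta h r i (qpow q w1%:R) (w2%:R * x)
      * qT h r n i w1 (qpow q w2%:R) =
  ((q - 1) / padic_log q) ^+ r / (1 - q) ^+ n *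
  \sum_(k < n.+1) 'C(n, k)%:R *
    ((-1) ^+ k * padic_exp (k%:R * (w1 * w2)%:R * x * padic_log q)) *
    \prod_(l < r) symmetric_factor w1 w2 ((k%:Z + h - l%:Z)%:~R * padic_log q).
Proof.
move=> w10 w20 q1 qr x1; set t := padic_log q.
have tr : a t < rho by rewrite abs_padic_log.
have t0 : t != 0 by rewrite -(abs_eq0 a) abs_padic_log // abs_eq0 subr_eq0.
have nz w : (0 < w)%N -> w%:R != 0 :> C by exact: Cp_natf_neq0.
have wtr w : a (w%:R * t) < rho by rewrite mulrC abs_scale_lt ?abs_nat_le1.
have wt0 w : (0 < w)%N -> w%:R * t != 0 by move=> w0; rewrite mulf_neq0 ?nz.
have int_r (m : int) : a (m%:~R * t) < rho.
  by rewrite mulrC abs_scale_lt // (abs_int_le1 abs_nat_le1).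
have q10 : 1 - q != 0 by rewrite subr_eq0 eq_sym.
set Q1 := padic_exp (w1%:R * t); set Q2 := padic_exp (w2%:R * t).
have Qw0 w : (0 < w)%N -> 1 - padic_exp (w%:R * t) != 0.
  by move=> w0; rewrite subr_eq0 eq_sym padic_exp_eq1 ?wt0.
have Q10 : 1 - Q1 != 0 by exact: Qw0.
have Q20 : 1 - Q2 != 0 by exact: Qw0.
have w2x : a (w2%:R * x) <= 1 by rewrite absvM mulr_ile1 ?absv_ge0 ?abs_nat_le1.
pose f k : C := (-1) ^+ k * padic_exp (k%:R * (w1 * w2)%:R * x * t) *
  \prod_(l < r) (bernoulli_gf (w1%:R * ((k%:Z + h - l%:Z)%:~R * t)) / w1%:R).
pose E (j : {ffun 'I_r -> 'I_w1}) : C :=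
  \prod_(l < r) padic_exp ((h - l%:Z)%:~R * (w2%:R * t)) ^+ j l.
pose s (j : {ffun 'I_r -> 'I_w1}) := (\sum_l j l)%N.
set K := _ / _ ^+ n.
transitivity (\sum_(i < n.+1) K * \sum_j E j *
    ('C(n, i)%:R * (1 - Q2 ^+ s j) ^+ (n - i) * (Q2 ^+ s j) ^+ i *
     umbral_pow 1 1 i f)).
  apply: eq_bigr => i _; have ile : (i <= n)%N by rewrite -ltnS.
  rewrite /qpow -/t qbeta_exp ?wtr ?wt0 // qT_exp ?wtr // -/Q1 -/Q2.
  set SJ := \sum_(j : {ffun _ -> _}) _.
  have -> : \sum_j E j * ('C(n, i)%:R * (1 - Q2 ^+ s j) ^+ (n - i) *
      (Q2 ^+ s j) ^+ i * umbral_pow 1 1 i f) =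
      'C(n, i)%:R * umbral_pow 1 1 i f * SJ.
    by rewrite mulr_sumr; apply: eq_bigr => j _; rewrite /E /s; ring.
  set SK := \sum_(k < i.+1) _.
  have -> : SK = ((Q1 - 1) / t) ^+ r * umbral_pow 1 1 i f.
    rewrite mulr_sumr; apply: eq_bigr => k _; rewrite !expr1n !mulr1 /f.
    have -> : k%:R * (w2%:R * x) * (w1%:R * t) = k%:R * (w1 * w2)%:R * x * t.
      by rewrite natrM; ring.
    rewrite [RHS]mulrCA; congr (_ * _); rewrite [RHS]mulrCA; congr (_ * _).
    have -> : ((Q1 - 1) / t) ^+ r = \prod_(l < r) ((Q1 - 1) / t).
      by rewrite prodr_const card_ord.
    rewrite -big_split /=; apply: eq_bigr => l _.
    rewrite [w1%:R * (_ * t)]mulrCA; field; by rewrite t0 nz.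
  rewrite /qnum -/t /qpow -/t -/Q1 -/Q2.
  have D1 : (1 - Q1) / (1 - q) != 0 by rewrite mulf_neq0 ?invr_eq0.
  rewrite exprzDr ?unitfE // -exprnN -exprnP /K !expr_div_n.
  have -> : (1 - q) ^+ n = (1 - q) ^+ (n - i) * (1 - q) ^+ i.
    by rewrite -exprD subnK.
  have -> : (Q1 - 1) ^+ r = (-1) ^+ r * (1 - Q1) ^+ r.
    by rewrite -exprMn mulN1r opprB.
  have -> : (q - 1) ^+ r = (-1) ^+ r * (1 - q) ^+ r.
    by rewrite -exprMn mulN1r opprB.
  by field; rewrite ?expf_neq0.
rewrite -mulr_sumr; congr (_ * _); rewrite exchange_big /=.
transitivity (\sum_j E j * umbral_pow 1 (Q2 ^+ s j) n f).
  apply: eq_bigr => j _; rewrite -umbral_pow_comp mulr_sumr.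
  by apply: eq_bigr.
transitivity (\sum_j \sum_(k < n.+1)
    E j * ('C(n, k)%:R * 1 ^+ (n - k) * (Q2 ^+ s j) ^+ k * f k)).
  by apply: eq_bigr => j _; rewrite mulr_sumr.
rewrite exchange_big /=; apply: eq_bigr => k _.
transitivity ('C(n, k)%:R * f k * \sum_j E j * (Q2 ^+ s j) ^+ k).
  by rewrite mulr_sumr; apply: eq_bigr => j _; rewrite expr1n; ring.
rewrite /f -!mulrA; do 3![congr (_ * _)].
rewrite /symmetric_factor [RHS]big_split /=; congr (_ * _).
rewrite bigA_distr_bigA /=; apply: eq_bigr => j _.
rewrite /E /s -exprM big_distrl -prodrXr -big_split /=; apply: eq_bigr => l _.
rewrite mulnC exprM -exprMn; congr (_ ^+ _).
rewrite /Q2 -padic_expMn // -padic_expD; last 2 first.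
- by rewrite mulrC abs_scale_lt // (abs_int_le1 abs_nat_le1).
- by rewrite -[_ * t *+ _]mulr_natr abs_scale_lt ?abs_nat_le1.
by congr padic_exp; rewrite -[_ * t *+ _]mulr_natr !rmorphB !rmorphD /=; ring.
Qed.

End PadicAnalysis.

Unset Implicit Arguments.

Theorem theorem6 (R : realType) (p : nat) (hp : prime p)
    (C : padic_complex R p) (n : nat) (h : int) (r w1 w2 : nat)
    (hr : (0 < r)%N) (hw1 : (0 < w1)%N) (hw2 : (0 < w2)%N)
    (q x : C) (hq1 : q != 1)
    (hq : absCp C (1 - q) < (p%:R : R) `^ (- (p%:R - 1)^-1))
    (hx : absCp C x <= 1) :
  \sum_(i < n.+1) ('C(n, i))%:R * qnum q w2%:R ^+ (n - i)
      * qnum q w1%:R ^ (i%:Z - r%:Z)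
      * qbeta h r i (qpow q w1%:R) (w2%:R * x)
      * qT h r n i w1 (qpow q w2%:R)
  = \sum_(i < n.+1) ('C(n, i))%:R * qnum q w1%:R ^+ (n - i)
      * qnum q w2%:R ^ (i%:Z - r%:Z)
      * qbeta h r i (qpow q w2%:R) (w1%:R * x)
      * qT h r n i w2 (qpow q w1%:R).
Proof.
have qr : absCp C (q - 1) < rho R p by rewrite absB.
rewrite !one_side_eq //; congr (_ * _); apply: eq_bigr => k _.
rewrite [(w2 * w1)%N]mulnC; congr (_ * _); apply: eq_bigr => l _.
apply: symmetric_factorC => //.
rewrite mulrC abs_scale_lt ?abs_padic_log //.
exact: abs_int_le1 (abs_nat_le1 C hp) _.
Qed.
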